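(* Let $p \geq 1$, let $\boldsymbol X = (X_1,X_2,\ldots,X_p)$ be an $\mathbb{R}^p$-valued infinitely divisible random vector such that $\mathbb{P}(X_r=0)<1$ for $r=1,2,\ldots,p$, and let $\beta_r \in [0,\infty)$, $r=1,2,\ldots,p$. Then the condition $$\mathbb{E} \left( \prod_{r=1}^{p} |X_r|^{\alpha_r} \right) < \infty \quad \text{for all } \alpha_r \in [0, \beta_r],\ r=1,2,\ldots,p,$$ is equivalent to the condition $$\mathbb{E} \left( \prod_{r=1}^{p} |X_r|^{\beta_r} \right) < \infty.$$ Moreover, $$\mathbb{P} \left\{ \prod_{r=1}^{p} |X_r| > 0 \right\} > 0.$$
   Context: A random vector is infinitely divisible if for every positive integer $n$ its distribution is the $n$-fold convolution of some probability distribution on $\mathbb{R}^p$. Convention: $|y|^0 = 1$ for all real $y$, including $y=0$. *)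

(* Defs.v *)
From HB Require Import structures.
From mathcomp Require Import all_boot all_order all_algebra.
From mathcomp Require Import all_classical all_reals all_analysis.
From mathcomp Require Import measurable_realfun.

Set Implicit Arguments.
Unset Strict Implicit.
Unset Printing Implicit Defensive.

Import Order.TTheory GRing.Theory Num.Theory.

Local Open Scope classical_set_scope.
Local Open Scope ring_scope.

(* R^p is the type p.-tuple R, whose canonical sigma-algebra is the one
   generated by the coordinate maps, that is, the Borel sigma-algebra of R^p. *)

Definition tuple_add (R : realType) (p : nat) (xy : p.-tuple R * p.-tuple R) :
    p.-tuple R :=
  [tuple tnth xy.1 i + tnth xy.2 i | i < p].

Lemma measurable_tuple_add (R : realType) (p : nat) :
  measurable_fun [set: p.-tuple R * p.-tuple R] (@tuple_add R p).
Proof.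
apply/measurable_fun_tnthP => i.
apply: (eq_measurable_fun
    (fun xy : p.-tuple R * p.-tuple R => tnth xy.1 i + tnth xy.2 i)).
  by move=> xy _; rewrite /= tnth_mktuple.
apply: measurable_funD.
- exact: (measurableT_comp (measurable_tnth i) measurable_fst).
- exact: (measurableT_comp (measurable_tnth i) measurable_snd).
Qed.

HB.instance Definition _ (R : realType) (p : nat) :=
  isMeasurableFun.Build _ _ _ _ (@tuple_add R p) (@measurable_tuple_add R p).

Definition convolution (R : realType) (p : nat)
    (mu nu : probability (p.-tuple R) R) : probability (p.-tuple R) R :=
  distribution (mu \x nu)%E (@tuple_add R p).

(* iterop makes the 1-fold convolution mu itself; the 0-fold one is the Dirac
   mass at the origin. *)
Definition convolution_power (R : realType) (p : nat)
    (mu : probability (p.-tuple R) R) (n : nat) : probability (p.-tuple R) R :=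
  iterop n (@convolution R p) mu \d_([tuple 0 | _ < p] : p.-tuple R).

(* Measures are compared on measurable sets only, because a measure is a
   function on all sets whose values elsewhere are unspecified. *)
Definition infinitely_divisible (R : realType) (p : nat)
    (mu : probability (p.-tuple R) R) : Prop :=
  forall n : nat, (0 < n)%N ->
    exists nu : probability (p.-tuple R) R,
      forall A : set (p.-tuple R), measurable A ->
        mu A = convolution_power nu n A.

(* Main.v *)
(** Write the law mu of X as nu * kappa with kappa = nu^{*(p^2+1)}.  The target
    is finiteness of the nu-integral of w(y) = prod_r (1 + |y_r|)^{beta_r}: w is
    submultiplicative, so it is then mu-integrable too, and it dominates every
    moment in question.

    By Fubini, kappa-almost every z makes y |-> prod_r |y_r + z_r|^{beta_r}
    nu-integrable.  Finitely many such z suffice to bound w by a constant times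
    the sum of these functions, as soon as for nu-almost every y some z has every
    |y_r + z_r| bounded below.  Where the r-th coordinate is nu-a.s. a constant c,
    y_r + z_r = (p^2+2)c is nonzero.  For each of the other coordinates, spend p
    summands of kappa on independent pairs (u, v) with u_r < v_r: replacing the u's
    by the v's one at a time gives p+1 points with distinct r-th coordinates.
    Doing so for all coordinates yields a grid of (p+1)^p points in which a given
    value of a given coordinate has frequency at most 1/(p+1), so p coordinates
    cannot rule out all of the points.  The same grid proves that the coordinates
    of X are simultaneously nonzero with positive probability. *)

Require Import Defs.
From HB Require Import structures.
From mathcomp Require Import all_boot all_order all_algebra.
From mathcomp Require Import all_classical all_reals all_analysis.
From mathcomp Require Import measurable_realfun lra.

Import Order.TTheory GRing.Theory Num.Theory.

Local Open Scope classical_set_scope.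
Local Open Scope ring_scope.

Set Implicit Arguments.
Unset Strict Implicit.

(** * Tuple addition, finite lists of reals, and a counting argument *)

Lemma tnth_tuple_add (R : realType) (p : nat) (y z : p.-tuple R) (r : 'I_p) :
  tnth (tuple_add (y, z)) r = tnth y r + tnth z r.
Proof. by rewrite tnth_mktuple. Qed.

Lemma tuple_addA (R : realType) (p : nat) (x y z : p.-tuple R) :
  tuple_add (x, tuple_add (y, z)) = tuple_add (tuple_add (x, y), z).
Proof. by apply: eq_from_tnth => r; rewrite !tnth_tuple_add addrA. Qed.

Lemma seq_norm_ub (R : realType) (s : seq R) :
  exists2 K, 0 <= K & forall x, x \in s -> `|x| <= K.
Proof.
elim: s => [|x s [K K0 sK]]; first by exists 0.
exists (Num.max `|x| K) => [|y]; first by rewrite le_max K0 orbT.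
by rewrite inE le_max => /predU1P[->|/sK ->]; rewrite ?lexx ?orbT.
Qed.

(** Applied below to differences of coordinates of grid points: it makes distinct coordinates
    uniformly separated. *)
Lemma seq_norm_gap (R : realType) (s : seq R) :
  exists2 delta, 0 < delta & forall x, x \in s -> x != 0 -> delta <= `|x|.
Proof.
elim: s => [|x s [delta delta0 sdelta]]; first by exists 1.
have [->|x0] := eqVneq x 0.
  exists delta => // y; rewrite inE => /predU1P[->|/sdelta//].
  by rewrite eqxx.
exists (Num.min `|x| delta) => [|y]; first by rewrite lt_min normr_gt0 x0.
by rewrite inE ge_min => /predU1P[-> _|/sdelta/[apply] ->];
  rewrite ?lexx ?orbT.
Qed.

(** Union bound: if every z were excluded by some r, summing the p counts would give |Z| (p+1) <= p
    |Z|, impossible for nonempty Z. *)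
Lemma exists_avoiding (S : eqType) (p : nat) (Z : seq S) (b : 'I_p -> pred S) :
  (0 < size Z)%N -> (forall r, count (b r) Z * p.+1 <= size Z)%N ->
  exists2 z, z \in Z & forall r, ~~ b r z.
Proof.
move=> Z0 bZ; apply: contrapT => noz.
suff : (size Z * p.+1 <= p * size Z)%N by rewrite mulnC leq_pmul2r // ltnn.
have szZ : (size Z <= \sum_(r < p) count (b r) Z)%N.
  rewrite (eq_bigr (fun r => \sum_(z <- Z) b r z)%N); last first.
    by move=> r _; rewrite -sum1_count big_mkcond.
  rewrite exchange_big /= -sum1_size big_seq [X in (_ <= X)%N]big_seq.
  apply: leq_sum => z zZ; rewrite lt0n sum_nat_eq0; apply/negP => /forallP nb.
  by apply: noz; exists z => // r; move: (nb r); case: (b r z).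
rewrite (leq_trans (leq_mul szZ (leqnn _))) // big_distrl /=.
by rewrite (leq_trans (leq_sum _ (fun r _ => bZ r))) // sum_nat_const card_ord.
Qed.

(** * Almost-everywhere statements under a probability measure *)

Section AlmostEverywhere.
Context d (T : measurableType d) (R : realType) (P : probability T R).

Lemma ae_ex (A : set T) : (\forall x \ae P, A x) -> exists x, A x.
Proof.
move=> PA.
have P0 : (0 < P setT)%E by rewrite probability_setT.
exact: (@filter_ex _ _ (ae_properfilter_algebraOfSetsType P0) _ PA).
Qed.

Lemma ae_all_seq (I : eqType) (s : seq I) (A : I -> set T) :
  (forall i, i \in s -> \forall x \ae P, A i x) ->
  \forall x \ae P, forall i, i \in s -> A i x.
Proof.
elim: s => [|j s IH] sA; first by apply: filterE.
have Aj := sA j (mem_head _ _).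
have As : \forall x \ae P, forall i, i \in s -> A i x.
  by apply: IH => i si; apply: sA; rewrite inE si orbT.
near=> x => i; rewrite inE => /predU1P[->|]; first by near: x.
by move: i; near: x.
Unshelve. all: by end_near. Qed.

Lemma ae_forall (I : finType) (A : I -> set T) :
  (forall i, \forall x \ae P, A i x) -> \forall x \ae P, forall i, A i x.
Proof. by move=> PA; apply: filter_forall. Qed.

Lemma ge0_integral_eq0_ae (f : T -> \bar R) : measurable_fun setT f ->
  (forall x, 0 <= f x)%E -> (\int[P]_x f x = 0)%E -> \forall x \ae P, f x = 0%E.
Proof.
move=> mf f0 If.
have [+ _] := ae_eq_integral_abs P measurableT mf.
have -> : (\int[P]_x `|f x| = 0)%E.
  by rewrite -[RHS]If; apply: eq_integral => x _; rewrite gee0_abs.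
by move/(_ erefl); apply: filterS => x; exact.
Qed.

Lemma ge0_integral_lty_ae (f : T -> \bar R) : measurable_fun setT f ->
  (forall x, 0 <= f x)%E -> (\int[P]_x f x < +oo)%E ->
  \forall x \ae P, (f x < +oo)%E.
Proof.
move=> mf f0 If.
have If' : P.-integrable setT f.
  apply/integrableP; split=> //.
  by under eq_integral => x _ do rewrite gee0_abs //.
apply: filterS (integrable_ae measurableT If') => x /(_ I) /fin_numPlt.
by case/andP.
Qed.

End AlmostEverywhere.

(** * Tonelli's theorem and null sets for convolutions *)

Section Convolution.
Context (R : realType) (p : nat).
Implicit Types nu kappa : probability (p.-tuple R) R.

Section Integral.
Context (nu kappa : probability (p.-tuple R) R) (f : p.-tuple R -> \bar R).
Hypotheses (mf : measurable_fun setT f) (f0 : forall x, (0 <= f x)%E).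

Let mfadd : measurable_fun setT (f \o @tuple_add R p).
Proof. exact: measurableT_comp mf (@measurable_tuple_add R p). Qed.

Lemma integral_convolutionE :
  (\int[convolution nu kappa]_x f x =
   \int[(nu \x kappa)%E]_x (f \o @tuple_add R p) x)%E.
Proof. exact: ge0_integral_distribution. Qed.

Lemma integral_convolution1 :
  (\int[convolution nu kappa]_x f x =
   \int[nu]_y \int[kappa]_z f (tuple_add (y, z)))%E.
Proof.
rewrite integral_convolutionE fubini_tonelli1 // => x; exact: f0.
Qed.

Lemma integral_convolution2 :
  (\int[convolution nu kappa]_x f x =
   \int[kappa]_z \int[nu]_y f (tuple_add (y, z)))%E.
Proof.
rewrite integral_convolutionE fubini_tonelli2 // => x; exact: f0.
Qed.

Lemma measurable_inner_integral1 :
  measurable_fun setT (fun y => \int[kappa]_z f (tuple_add (y, z)))%E.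
Proof.
apply: (measurable_fun_fubini_tonelli_F (f \o @tuple_add R p)) => // x.
exact: f0.
Qed.

Lemma measurable_inner_integral2 :
  measurable_fun setT (fun z => \int[nu]_y f (tuple_add (y, z)))%E.
Proof.
apply: (measurable_fun_fubini_tonelli_G (f \o @tuple_add R p)) => // x.
exact: f0.
Qed.

Lemma measurable_tuple_addl z :
  measurable_fun setT (fun y => f (tuple_add (y, z))).
Proof.
apply: (measurableT_comp mfadd).
exact: (measurable_pair2 z).
Qed.

Lemma measurable_tuple_addr y :
  measurable_fun setT (fun z => f (tuple_add (y, z))).
Proof.
apply: (measurableT_comp mfadd).
exact: (measurable_pair1 y).
Qed.

End Integral.

Lemma integral_indic_null kappa (N : set (p.-tuple R)) : measurable N ->
  kappa N = 0%E -> (\int[kappa]_x (\1_N x)%:E = 0)%E.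
Proof. by move=> mN N0; rewrite integral_indic // setIT. Qed.

(** A measurable null set covering the exceptions has an indicator of integral zero, so by Tonelli
    almost all inner integrals of that indicator vanish. *)
Lemma ae_convolution1 nu kappa (G : set (p.-tuple R)) :
  (\forall x \ae convolution nu kappa, G x) ->
  \forall y \ae nu, \forall z \ae kappa, G (tuple_add (y, z)).
Proof.
move=> -[N [mN N0 GN]].
have mf : measurable_fun setT (fun x : p.-tuple R => (\1_N x)%:E : \bar R).
  exact/measurable_EFinP/measurable_indic.
have f0 (x : p.-tuple R) : (0 <= (\1_N x : R)%:E)%E by rewrite lee_fin.
have I0 := integral_indic_null mN N0.
rewrite (integral_convolution1 nu kappa mf f0) in I0.
have := ge0_integral_eq0_ae (measurable_inner_integral1 kappa mf f0) _ I0.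
move=> /(_ (fun y => integral_ge0 _ (fun z _ => f0 _))).
apply: filterS => y /(ge0_integral_eq0_ae (measurable_tuple_addr mf y)).
move=> /(_ (fun z => f0 _)); apply: filterS => z [].
rewrite indicE; case: (boolP (_ \in N)); first by move=> _ /eqP; rewrite oner_eq0.
rewrite notin_setE => nN _; apply: contrapT => nG; exact/nN/GN.
Qed.

Lemma ae_convolution2 nu kappa (G : set (p.-tuple R)) :
  (\forall x \ae convolution nu kappa, G x) ->
  \forall z \ae kappa, \forall y \ae nu, G (tuple_add (y, z)).
Proof.
move=> -[N [mN N0 GN]].
have mf : measurable_fun setT (fun x : p.-tuple R => (\1_N x)%:E : \bar R).
  exact/measurable_EFinP/measurable_indic.
have f0 (x : p.-tuple R) : (0 <= (\1_N x : R)%:E)%E by rewrite lee_fin.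
have I0 := integral_indic_null mN N0.
rewrite (integral_convolution2 nu kappa mf f0) in I0.
have := ge0_integral_eq0_ae (measurable_inner_integral2 nu mf f0) _ I0.
move=> /(_ (fun y => integral_ge0 _ (fun z _ => f0 _))).
apply: filterS => z /(ge0_integral_eq0_ae (measurable_tuple_addl mf z)).
move=> /(_ (fun z => f0 _)); apply: filterS => y [].
rewrite indicE; case: (boolP (_ \in N)); first by move=> _ /eqP; rewrite oner_eq0.
rewrite notin_setE => nN _; apply: contrapT => nG; exact/nN/GN.
Qed.

Lemma measurable_tnth_eq (r : 'I_p) (c : R) :
  measurable [set x : p.-tuple R | tnth x r = c].
Proof.
rewrite (_ : [set _ | _] = (fun x : p.-tuple R => tnth x r) @^-1` [set c]) //.
rewrite -[X in measurable X]setTI; exact: measurable_tnth.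
Qed.

(** Converse of [ae_convolution1]: Tonelli is applied to the indicator of the complement of [G],
    whence the measurability of [G]. *)
Lemma ae_convolutionI nu kappa (G : set (p.-tuple R)) : measurable G ->
  (\forall y \ae nu, \forall z \ae kappa, G (tuple_add (y, z))) ->
  \forall x \ae convolution nu kappa, G x.
Proof.
move=> /measurableC mN nkG; apply/negligibleP => //.
have mf : measurable_fun setT (fun x : p.-tuple R => (\1_(~` G) x)%:E : \bar R).
  exact/measurable_EFinP/measurable_indic.
have f0 (x : p.-tuple R) : (0 <= (\1_(~` G) x : R)%:E)%E by rewrite lee_fin.
suff : (\int[convolution nu kappa]_x (\1_(~` G) x)%:E = 0)%E.
  by rewrite integral_indic // setIT.
rewrite (integral_convolution1 nu kappa mf f0) -[RHS](integral0 nu setT).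
apply: ae_eq_integral => //.
  by have := measurable_inner_integral1 kappa mf f0.
apply: filterS nkG => y kG _.
rewrite -[RHS](integral0 kappa setT).
apply: ae_eq_integral => //; first exact: measurable_tuple_addr mf y.
apply: filterS kG => z Gyz _.
by rewrite indicE memNset.
Qed.

Lemma ae_convolution_tnth nu kappa (r : 'I_p) (a b : R) :
  (\forall y \ae nu, tnth y r = a) -> (\forall z \ae kappa, tnth z r = b) ->
  \forall x \ae convolution nu kappa, tnth x r = a + b.
Proof.
move=> nua kappab; apply: ae_convolutionI (measurable_tnth_eq r (a + b)) _.
apply: filterS nua => y ya; apply: filterS kappab => z zb.
by rewrite /= tnth_tuple_add ya zb.
Qed.

(** Iterating n times from [nu] gives n + 1 summands, hence the multiple [n.+1]. *)
Lemma ae_convolution_iter_tnth nu (r : 'I_p) (c : R) (n : nat) :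
  (\forall y \ae nu, tnth y r = c) ->
  \forall x \ae iter n (convolution nu) nu, tnth x r = c *+ n.+1.
Proof.
move=> nuc; elim: n => [|n IH] //=.
by rewrite mulrS; apply: ae_convolution_tnth.
Qed.


(** * Chains and grids of points in a set of full measure *)

Definition degenerate nu (r : 'I_p) := exists c, \forall y \ae nu, tnth y r = c.

(** If no two points of [A] had strictly ordered r-th coordinates, that coordinate would be constant
    on [A], hence degenerate. *)
Lemma ae_lt_pair nu (r : 'I_p) (A : set (p.-tuple R)) :
  ~ degenerate nu r -> (\forall y \ae nu, A y) ->
  exists y y', [/\ A y, A y' & tnth y r < tnth y' r].
Proof.
move=> ndeg nuA; apply: contrapT => nlt; apply: ndeg.
have [y0 Ay0] := ae_ex nuA.
exists (tnth y0 r); apply: filterS nuA => y Ay.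
apply/eqP; rewrite eq_le !leNgt; apply/andP; split; apply/negP => lt_y.
- by apply: nlt; exists y0, y.
- by apply: nlt; exists y, y0.
Qed.

(** The law is nu^{*M} * kappa. Each summand [nu] is peeled off and supplies good values y, y' with
    y_r < y'_r; in the degenerate case y' = y, since no ordering is then claimed. *)
Lemma convolution_chain nu kappa (r : 'I_p) (M : nat) (G : set (p.-tuple R)) :
  (\forall x \ae iter M (convolution nu) kappa, G x) ->
  exists c : nat -> p.-tuple R,
    (~ degenerate nu r ->
       forall i j, (i < j <= M)%N -> tnth (c i) r < tnth (c j) r) /\
    \forall z \ae kappa, forall i, (i <= M)%N -> G (tuple_add (c i, z)).
Proof.
elim: M G => [|M IH] G /=.
  move=> kG; exists (fun=> [tuple 0 | _ < p]); split.
    by move=> _ i j /andP[ij]; rewrite leqn0 => /eqP j0; rewrite j0 in ij.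
  apply: filterS kG => z Gz i _.
  congr G: Gz; apply: eq_from_tnth => s.
  by rewrite tnth_tuple_add tnth_mktuple add0r.
move=> /ae_convolution1 nuG.
have [y [y' [Gy Gy' yy']]] : exists y y',
    [/\ \forall x \ae iter M (convolution nu) kappa, G (tuple_add (y, x)),
        \forall x \ae iter M (convolution nu) kappa, G (tuple_add (y', x)) &
        (~ degenerate nu r -> tnth y r < tnth y' r)].
  have [deg|ndeg] := pselect (degenerate nu r).
    by have [y Gy] := ae_ex nuG; exists y, y; split.
  by have [y [y' [Gy Gy' ltyy']]] := ae_lt_pair ndeg nuG; exists y, y'; split.
have [c [clt kG]] := IH _ (filterI Gy Gy').
(* The new chain is y + c_0, y' + c_0, ..., y' + c_M: y is first replaced by y', then the old chain
   is followed. *)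
exists (fun i => if i is j.+1 then tuple_add (y', c j) else tuple_add (y, c 0)).
split=> [ndeg [|i] [|j] //|].
- rewrite ltnS => /= jM; rewrite !tnth_tuple_add.
  apply: ltr_leD; first exact: yy'.
  by case: j jM => // j jM; apply/ltW/clt.
- by rewrite !ltnS => ijM; rewrite !tnth_tuple_add ltrD2l clt.
apply: filterS kG => z Gz [_|i]; rewrite -tuple_addA.
  by have [] := Gz 0 isT.
by rewrite ltnS => /Gz[].
Qed.

Lemma count_chain (S : eqType) (M : nat) (c : nat -> S) (v : S) :
  (forall i j, (i <= M)%N -> (j <= M)%N -> c i = c j -> i = j) ->
  (count (fun i => c i == v) (iota 0 M.+1) <= 1)%N.
Proof.
move=> cI; have cU : uniq (map c (iota 0 M.+1)).
  rewrite map_inj_in_uniq ?iota_uniq // => i j.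
  rewrite !mem_iota !add0n !ltnS => /andP[_ iM] /andP[_ jM]; exact: cI.
by rewrite -(count_map c (pred1 v)) count_uniq_mem // leq_b1.
Qed.

(** Induction on [rs]: each coordinate spends M summands on a chain, and the new grid consists of
    all sums of a chain point and an old grid point. Its size is thus multiplied by M + 1. *)
Lemma convolution_grid nu kappa (rs : seq 'I_p) (M : nat)
    (G : set (p.-tuple R)) :
  (\forall x \ae iter (size rs * M) (convolution nu) kappa, G x) ->
  exists Z : seq (p.-tuple R),
    [/\ (0 < size Z)%N, forall z, z \in Z -> G z &
        forall r v, r \in rs -> ~ degenerate nu r ->
          (count (fun z => tnth z r == v) Z * M.+1 <= size Z)%N].
Proof.
elim: rs G => [|r rs IH] G /=.
  move=> /ae_ex[z Gz]; exists [:: z]; split=> // z'.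
  by rewrite inE => /eqP ->.
(* The chain lemma is used with the law of the remaining summands in place of [kappa]. *)
rewrite mulSn iterD => /(convolution_chain r)[c [clt kG]].
have [Z [Z0 ZG Zc]] := IH _ kG.
exists [seq tuple_add (c i, z) | z <- Z, i <- iota 0 M.+1].
have szZ : size [seq tuple_add (c i, z) | z <- Z, i <- iota 0 M.+1] =
    (size Z * M.+1)%N by rewrite size_allpairs size_iota.
split; rewrite ?szZ ?muln_gt0 ?Z0 //.
  move=> _ /allpairsP[[z i] [zZ iM ->]].
  by apply: ZG => //; move: iM; rewrite mem_iota add0n ltnS.
move=> s v; rewrite inE => s_rs ndeg; rewrite leq_pmul2r //.
have -> : count (fun z => tnth z s == v)
      [seq tuple_add (c i, z) | z <- Z, i <- iota 0 M.+1] =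
    (\sum_(z <- Z) \sum_(i <- iota 0 M.+1)
       ((tnth (c i) s + tnth z s)%R == v))%N.
  rewrite -sum1_count big_mkcond big_allpairs_dep /=.
  apply: eq_bigr => z _; apply: eq_bigr => i _.
  by rewrite tnth_tuple_add; case: eqP.
(* For s in the tail, fix i: adding c_i only shifts the value v, so the inductive bound holds for
   each i and is summed. *)
have [s_in|s_notin] := boolP (s \in rs).
  rewrite exchange_big /= -(@leq_pmul2r M.+1) // big_distrl /=.
  have -> : (size Z * M.+1 = \sum_(i <- iota 0 M.+1) size Z)%N.
    by rewrite big_const_seq count_predT size_iota iter_addn_0.
  apply: leq_sum => i _.
  rewrite (leq_trans _ (Zc s (v - tnth (c i) s) s_in ndeg)) // leq_mul2r /=.
  rewrite -sum1_count [X in (_ <= X)%N]big_mkcond /=; apply: leq_sum => z _.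
  by rewrite [tnth z s == _]eq_sym subr_eq [v == _]eq_sym addrC; case: eqP.
(* For the new coordinate, fix z: the chain is strictly increasing there, so at most one i gives the
   value v. *)
move: s_rs; rewrite (negPf s_notin) orbF => /eqP sr; rewrite {s s_notin}sr in ndeg *.
rewrite -sum1_size; apply: leq_sum => z _.
rewrite (leq_trans _ (@count_chain _ M (fun i => tnth (c i) r) (v - tnth z r) _)) //.
  rewrite -sum1_count [X in (_ <= X)%N]big_mkcond /=; apply: leq_sum => i _.
  by rewrite [tnth (c i) r == _]eq_sym subr_eq [v == _]eq_sym; case: eqP.
move=> i j iM jM cij.
have [ij|ij|//] := ltngtP i j.
- by have := clt ndeg i j; rewrite ij jM cij ltxx => /(_ isT).
- by have := clt ndeg j i; rewrite ij iM cij ltxx => /(_ isT).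
Qed.

(** * Translates that control 1 + |y_r| in all coordinates at once *)

Lemma norm_add_bound (delta K y z : R) : 0 < delta -> `|z| <= K ->
  delta <= `|y + z| -> 1 + `|y| <= ((1 + K) / delta + 1) * `|y + z|.
Proof.
move=> delta0 zK dyz; rewrite mulrDl mul1r.
have yz : `|y| <= `|y + z| + `|z|.
  by rewrite -[X in `|X| <= _](addrK z); apply: ler_normB.
have K1 : 1 + K <= (1 + K) / delta * `|y + z|.
  rewrite -mulrA ler_peMr //; last by rewrite mulrC ler_pdivlMr // mul1r.
  by rewrite addr_ge0 // (le_trans _ zK).
lra.
Qed.

(** For fixed y, the grid points with |y_r + z_r| small share a single r-th coordinate, so each
    nondegenerate r excludes at most 1/(p+1) of the grid and some point survives all r. Here [kappa]
    is the law left over after the p^2 summands of the grid. *)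
Lemma comparable_translates nu kappa (G : set (p.-tuple R)) :
  (\forall x \ae iter (p * p) (convolution nu) kappa, G x) ->
  (forall r, degenerate nu r -> exists2 e, e != 0 &
     \forall y \ae nu, forall z, G z -> tnth y r + tnth z r = e) ->
  exists (Z : seq (p.-tuple R)) (C : 'I_p -> R),
    [/\ forall z, z \in Z -> G z, forall r, 0 <= C r &
        \forall y \ae nu, exists2 z, z \in Z &
          forall r, 1 + `|tnth y r| <= C r * `|tnth y r + tnth z r| ].
Proof.
(* The grid runs over all p coordinates, with M = p summands for each. *)
move=> kG degG; have := kG; rewrite -[X in (X * _)%N](size_enum_ord p).
move=> /convolution_grid[Z [Z0 ZG Zc]].
have [K K0 ZK] := seq_norm_ub [seq tnth z r | z <- Z, r <- enum 'I_p].
have [delta delta0 Zdelta] := seq_norm_gap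
  (flatten [seq [seq tnth z r - tnth z' r | z <- Z, z' <- Z] | r <- enum 'I_p]).
(* The constant depends on r only. A nondegenerate coordinate needs the lower bound delta / 2; in a
   degenerate one y_r + z_r equals the nonzero e. *)
have : forall r, exists Cr, 0 <= Cr /\ \forall y \ae nu, forall z, z \in Z ->
    (~ degenerate nu r -> delta / 2 <= `|tnth y r + tnth z r|) ->
    1 + `|tnth y r| <= Cr * `|tnth y r + tnth z r|.
  move=> r; have [deg|ndeg] := pselect (degenerate nu r); last first.
    exists ((1 + K) / (delta / 2) + 1).
    split; first by rewrite addr_ge0 // divr_ge0 ?addr_ge0 // divr_ge0 // ltW.
    apply: filterE => y z zZ /(_ ndeg); apply: norm_add_bound.
      by rewrite divr_gt0.
    by apply: ZK; apply/allpairsP; exists (z, r); rewrite mem_enum.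
  have [e e0 nue] := degG _ deg; have [c nuc] := deg.
  exists ((1 + `|c|) / `|e|); split; first by rewrite divr_ge0 // addr_ge0.
  apply: filterS2 nue nuc => y ye yc z /ZG Gz _.
  by rewrite (ye z Gz) yc divfK // normr_eq0.
move=> /choice[C C_]; exists Z, C; split=> [//|r|]; first by have [] := C_ r.
have : \forall y \ae nu, forall r, forall z, z \in Z ->
    (~ degenerate nu r -> delta / 2 <= `|tnth y r + tnth z r|) ->
    1 + `|tnth y r| <= C r * `|tnth y r + tnth z r|.
  by apply: ae_forall => r; have [] := C_ r.
apply: filterS => y Cy.
pose b r z := `[< ~ degenerate nu r >] && (`|tnth y r + tnth z r| < delta / 2).
have [r|z zZ nb] := @exists_avoiding _ p Z b Z0; last first.
  exists z => // r; apply: Cy => // ndeg; rewrite leNgt.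
  by have := nb r; rewrite /b; case: asboolP.
have [ndeg|deg] := pselect (~ degenerate nu r); last first.
  rewrite (@eq_count _ _ pred0) ?count_pred0 // => z.
  by rewrite /b; case: asboolP.
have [/hasP[z0 z0Z bz0]|] := boolP (has (b r) Z); last first.
  by rewrite has_count -leqNgt leqn0 => /eqP ->.
(* Two bad points have r-th coordinates less than delta apart, hence equal ones: all bad points
   share the coordinate of z0. *)
rewrite (leq_trans _ (Zc r (tnth z0 r) (mem_enum _ _) ndeg)) // leq_pmul2r //.
rewrite (@eq_in_count _ _ (fun z => b r z && (tnth z r == tnth z0 r))).
  by apply: sub_count => z /= /andP[].
move=> z zZ; rewrite andb_idr // => bz; apply: contraT => zz0.
have : delta <= `|tnth z r - tnth z0 r|.
  apply: Zdelta; last by rewrite subr_eq0.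
  apply/flattenP; exists [seq tnth z r - tnth z' r | z <- Z, z' <- Z].
    by apply: map_f; rewrite mem_enum.
  by apply/allpairsP; exists (z, z0).
case/andP: bz => _ bz; case/andP: bz0 => _ bz0.
have : `|tnth z r - tnth z0 r| <=
    `|tnth y r + tnth z r| + `|tnth y r + tnth z0 r|.
  rewrite (_ : tnth z r - _ = (tnth y r + tnth z r) - (tnth y r + tnth z0 r)).
    exact: ler_normB.
  by rewrite opprD addrACA subrr add0r.
move: bz bz0; lra.
Qed.


(** * Moments and the submultiplicative weight *)

Lemma measurable_moment (beta : 'I_p -> R) :
  measurable_fun setT
    (fun x : p.-tuple R => (\prod_(r < p) `|tnth x r| `^ beta r)%:E).
Proof.
apply/measurable_EFinP/measurable_prod => r _.
apply: (measurableT_comp (measurable_powR (beta r))).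
exact: (measurableT_comp (@normr_measurable R setT) (measurable_tnth r)).
Qed.

Definition moment_weight (beta : 'I_p -> R) (x : p.-tuple R) : \bar R :=
  (\prod_(r < p) (1 + `|tnth x r|) `^ beta r)%:E.

Lemma measurable_moment_weight (beta : 'I_p -> R) :
  measurable_fun setT (moment_weight beta).
Proof.
apply/measurable_EFinP/measurable_prod => r _.
apply: (measurableT_comp (measurable_powR (beta r))).
apply: measurable_funD => //.
exact: (measurableT_comp (@normr_measurable R setT) (measurable_tnth r)).
Qed.

Lemma moment_weight_ge0 (beta : 'I_p -> R) x : (0 <= moment_weight beta x)%E.
Proof. by rewrite lee_fin prodr_ge0 // => r _; exact: powR_ge0. Qed.

(** Coordinatewise 1 + |a + b| <= (1 + |a|)(1 + |b|), and t^beta_r is monotone for beta_r >= 0. *)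
Lemma moment_weightM (beta : 'I_p -> R) y z : (forall r, 0 <= beta r) ->
  (moment_weight beta (tuple_add (y, z)) <=
   moment_weight beta y * moment_weight beta z)%E.
Proof.
move=> beta0; rewrite -EFinM lee_fin -big_split /=.
apply: ler_prod => r _; rewrite powR_ge0 -powRM ?addr_ge0 //=.
rewrite ge0_ler_powR ?nnegrE ?mulr_ge0 ?addr_ge0 // tnth_tuple_add.
have := ler_normD (tnth y r) (tnth z r).
have := mulr_ge0 (normr_ge0 (tnth y r)) (normr_ge0 (tnth z r)).
lra.
Qed.

Lemma moment_weight_convolution nu kappa (beta : 'I_p -> R) :
  (forall r, 0 <= beta r) ->
  (\int[nu]_y moment_weight beta y < +oo)%E ->
  (\int[kappa]_z moment_weight beta z < +oo)%E ->
  (\int[convolution nu kappa]_x moment_weight beta x < +oo)%E.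
Proof.
move=> beta0 nuw kappaw.
have mw := measurable_moment_weight beta.
have w0 := moment_weight_ge0 beta.
have I0 (m : probability (p.-tuple R) R) : (0 <= \int[m]_x moment_weight beta x)%E.
  by apply: integral_ge0 => x _.
rewrite (integral_convolution1 nu kappa mw w0).
apply: (@le_lt_trans _ _ (\int[nu]_y
   (moment_weight beta y * \int[kappa]_z moment_weight beta z)))%E.
  apply: ge0_le_integral => //.
  - by move=> y _; apply: integral_ge0.
  - by have := measurable_inner_integral1 kappa mw w0.
  - apply: emeasurable_funM => //; exact: measurable_cst.
  move=> y _; rewrite -ge0_integralZl //.
  apply: ge0_le_integral => //.
  - by have := measurable_tuple_addr mw y.
  - apply: emeasurable_funM => //; exact: measurable_cst.
  by move=> z _; apply: moment_weightM.
rewrite ge0_integralZr //.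
apply: lte_mul_pinfty => //; first by have := I0 nu.
by rewrite ge0_fin_numE //; have := I0 nu.
Qed.

Lemma moment_weight_iter nu (beta : 'I_p -> R) (n : nat) :
  (forall r, 0 <= beta r) ->
  (\int[nu]_y moment_weight beta y < +oo)%E ->
  (\int[iter n (convolution nu) nu]_x moment_weight beta x < +oo)%E.
Proof.
by move=> beta0 nuw; elim: n => //= n IH; apply: moment_weight_convolution.
Qed.

(** * Consequences for convolution powers of one law *)

Lemma comparable_translates_iter nu (G : set (p.-tuple R)) :
  let kappa := iter (p * p) (convolution nu) nu in
  (forall r, ~ \forall y \ae nu, tnth y r = 0) ->
  (\forall x \ae kappa, G x) ->
  exists (Z : seq (p.-tuple R)) (C : 'I_p -> R),
    [/\ forall z, z \in Z -> G z, forall r, 0 <= C r &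
        \forall y \ae nu, exists2 z, z \in Z &
          forall r, 1 + `|tnth y r| <= C r * `|tnth y r + tnth z r| ].
Proof.
move=> kappa nu0 kG.
have : forall r, exists c, degenerate nu r -> \forall y \ae nu, tnth y r = c.
  move=> r; have [[c nuc]|ndeg] := pselect (degenerate nu r); first by exists c.
  by exists 0.
move=> /choice[c c_].
(* Refining [G] pins each degenerate z_r to (p^2+1) c_r, so that y_r + z_r = (p^2+2) c_r, nonzero
   because y_r is not a.s. zero. *)
pose G' z := G z /\ forall r, degenerate nu r -> tnth z r = c r *+ (p * p).+1.
have kG' : \forall x \ae kappa, G' x.
  apply: filterI => //; apply: ae_forall => r.
  have [deg|ndeg] := pselect (degenerate nu r); last by apply: filterE.
  by apply: filterS (ae_convolution_iter_tnth (p * p) (c_ r deg)) => z.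
have [|Z [C [ZG' C0 Cy]]] := comparable_translates kG'.
  move=> r deg; exists (c r *+ (p * p).+2).
    rewrite mulrn_eq0 /=; apply/eqP => c0; apply: (nu0 r).
    by rewrite -c0; apply: c_.
  apply: filterS (c_ r deg) => y yc z [_ Gz].
  by rewrite yc Gz // [in RHS]mulrS.
by exists Z, C; split=> // z /ZG'[].
Qed.

(** Otherwise, for almost every y, the product for y + z would vanish at all of the finitely many z.
    Yet one z satisfies C_r |y_r + z_r| >= 1 + |y_r| > 0 for every r. *)
Lemma prod_norm_nonnull nu :
  let kappa := iter (p * p) (convolution nu) nu in
  (forall r, ~ \forall y \ae nu, tnth y r = 0) ->
  ~ \forall x \ae convolution nu kappa, \prod_(r < p) `|tnth x r| = 0.
Proof.
move=> kappa nu0 /ae_convolution2 kG.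
have [Z [C [ZG C0 Cy]]] := comparable_translates_iter nu0 kG.
have [y [[z zZ yz] Gy]] := ae_ex (filterI Cy (ae_all_seq ZG)).
have := Gy z zZ; apply/eqP/prodf_neq0 => r _.
rewrite normr_eq0 tnth_tuple_add; apply: contraTneq (yz r) => ->.
by rewrite normr0 mulr0 -ltNge ltr_wpDr.
Qed.

Lemma moment_weight_lty nu (beta : 'I_p -> R) :
  let kappa := iter (p * p) (convolution nu) nu in
  (forall r, ~ \forall y \ae nu, tnth y r = 0) -> (forall r, 0 <= beta r) ->
  (\int[convolution nu kappa]_x (\prod_(r < p) `|tnth x r| `^ beta r)%:E
    < +oo)%E ->
  (\int[nu]_y moment_weight beta y < +oo)%E.
Proof.
move=> kappa nu0 beta0.
pose h (x : p.-tuple R) : \bar R := (\prod_(r < p) `|tnth x r| `^ beta r)%:E.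
have mh : measurable_fun setT h := measurable_moment beta.
have h0 x : (0 <= h x)%E by rewrite lee_fin prodr_ge0 // => r _; exact: powR_ge0.
rewrite (integral_convolution2 nu kappa mh h0).
move=> /(ge0_integral_lty_ae (measurable_inner_integral2 nu mh h0)).
move=> /(_ (fun z => integral_ge0 _ (fun y _ => h0 _))) kG.
(* Every z in Z has a finite inner integral. With D below, w(y) <= D h(y + z) for some z in Z, hence
   w is at most the sum over Z. *)
have [Z [C [ZG C0 Cy]]] := comparable_translates_iter nu0 kG.
pose D := \prod_(r < p) C r `^ beta r.
have D0 : 0 <= D by apply: prodr_ge0 => r _; exact: powR_ge0.
have mDh z : measurable_fun setT (fun y => D%:E * h (tuple_add (y, z)))%E.
  apply: emeasurable_funM; first exact: measurable_cst.
  by have := measurable_tuple_addl mh z.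
have Dh0 z y : (0 <= D%:E * h (tuple_add (y, z)))%E by apply: mule_ge0.
apply: (@le_lt_trans _ _
  (\int[nu]_y \sum_(z <- Z) (D%:E * h (tuple_add (y, z)))))%E.
  apply: ae_ge0_le_integral => //.
  - by move=> y _; exact: moment_weight_ge0.
  - by have := measurable_moment_weight beta.
  - by move=> y _; apply: sume_ge0 => z _.
  - by apply: emeasurable_sum => z.
  apply: filterS Cy => y [z zZ yz] _.
  rewrite (big_rem z) //= -[X in (X <= _)%E]adde0; apply: leeD; last first.
    by apply: sume_ge0 => z' _.
  rewrite -EFinM lee_fin -big_split /=; apply: ler_prod => r _.
  rewrite powR_ge0 -powRM //= ge0_ler_powR ?nnegrE ?mulr_ge0 ?addr_ge0 //.
  by rewrite tnth_tuple_add.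
rewrite ge0_integral_sum // big_seq; apply: lte_sum_pinfty => z zZ.
rewrite ge0_integralZl //; last by have := measurable_tuple_addl mh z.
by apply: lte_mul_pinfty => //; apply: ZG.
Qed.

End Convolution.

(** * The equivalence and the positivity statement *)

Unset Implicit Arguments.

Theorem theorem2 (R : realType) (d : measure_display) (T : measurableType d)
    (P : probability T R) (p : nat) (hp : (1 <= p)%N)
    (X : {RV P >-> p.-tuple R})
    (hX : infinitely_divisible (distribution P X))
    (hX0 : forall r : 'I_p, (P [set w | tnth (X w) r = 0%R] < 1)%E)
    (beta : 'I_p -> R) (hbeta : forall r : 'I_p, 0 <= beta r) :
  ((forall alpha : 'I_p -> R, (forall r : 'I_p, 0 <= alpha r <= beta r) ->
      ('E_P[fun w => (\prod_(r < p) `|tnth (X w) r| `^ alpha r)%R] < +oo)%E)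
   <->
   ('E_P[fun w => (\prod_(r < p) `|tnth (X w) r| `^ beta r)%R] < +oo)%E)
  /\ (0 < P [set w | (0 < \prod_(r < p) `|tnth (X w) r|)%R])%E.
Proof.
(* Of the p^2 + 2 summands, p^2 build the grid, one is its base point, and one is the y being
   translated. *)
have [nu muE] := hX (p * p).+2 isT.
pose kappa := iter (p * p) (@convolution R p nu) nu.
rewrite /convolution_power iteropS iterS -/kappa in muE.
have aemu (A : set (p.-tuple R)) : measurable A ->
    (\forall x \ae convolution nu kappa, A x) -> P (X @^-1` A) = 1%E.
  move=> mA /(negligibleP _ (measurableC mA)) A0.
  transitivity (convolution nu kappa A); first exact: muE.
  have := probability_setC (convolution nu kappa) (measurableC mA).
  by rewrite setCK A0 sube0.
(* If y_r were a.s. zero under [nu], then X_r would be a.s. zero, against [hX0]. *)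
have nu0 r : ~ \forall y \ae nu, tnth y r = 0.
  move=> /(ae_convolution_iter_tnth (p * p).+1); rewrite mul0rn iterS => nu0.
  have := hX0 r; rewrite (_ : [set w | _] = X @^-1` [set x | tnth x r = 0]) //.
  by rewrite (aemu _ (measurable_tnth_eq r 0)) ?ltxx.
split; last first.
  pose f (x : p.-tuple R) := \prod_(r < p) `|tnth x r|.
  have mf : measurable_fun setT f.
    apply: measurable_prod => r _.
    exact: (measurableT_comp (@normr_measurable R setT) (measurable_tnth r)).
  have mf0 : measurable (f @^-1` [set 0]) by rewrite -[X in measurable X]setTI; exact: mf.
  rewrite lt0e measure_ge0 andbT; apply/eqP => P0.
  apply: (prod_norm_nonnull nu0).
  apply/(negligibleP _ (measurableC mf0)).
  apply: (etrans (esym (muE _ (measurableC mf0)))).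
  rewrite -[RHS]P0; congr (P _); apply/seteqP; split=> w /=.
    by move=> /eqP fw0; rewrite lt0r fw0 prodr_ge0.
  by move=> fw0 f0; rewrite -/(f (X w)) f0 ltxx in fw0.
have momentE (alpha : 'I_p -> R) :
    ('E_P[fun w => (\prod_(r < p) `|tnth (X w) r| `^ alpha r)%R] =
     \int[convolution nu kappa]_x (\prod_(r < p) `|tnth x r| `^ alpha r)%:E)%E.
  rewrite [@expectation.body]unlock -(@eq_measure_integral _ _ _ _ _ (distribution P X)); last first.
    by move=> A mA _; exact: muE.
  rewrite ge0_integral_distribution  //.
    by have := measurable_moment alpha.
  by move=> x; rewrite lee_fin prodr_ge0 // => r _; exact: powR_ge0.
split=> [Ealpha|Ebeta alpha alpha_beta].
  by apply: Ealpha => r; rewrite hbeta lexx.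
have w_lty := moment_weight_lty nu0 hbeta.
(* Finiteness of the weight passes from [nu] back to the law of X, its (p^2+2)-fold power; there the
   weight dominates the alpha-moment. *)
rewrite momentE in Ebeta; have /= := moment_weight_iter (p * p).+1 hbeta (w_lty Ebeta).
rewrite momentE; apply: le_lt_trans.
apply: ge0_le_integral => //.
- by move=> x _; rewrite lee_fin prodr_ge0 // => r _; exact: powR_ge0.
- by have := measurable_moment alpha.
- by have := measurable_moment_weight beta.
move=> x _; rewrite lee_fin; apply: ler_prod => r _; rewrite powR_ge0 /=.
have /andP[alpha0 alphab] := alpha_beta r.
(* Raising the base to at least 1 makes the power monotone in the exponent, which |x_r| alone would
   not. *)
apply: (@le_trans _ _ ((1 + `|tnth x r|) `^ alpha r)).
  by rewrite ge0_ler_powR ?nnegrE ?addr_ge0 // lerDr.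
by apply: ler_powR; rewrite ?lerDl.
Qed.
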